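(* Let $\mathbb{V}$ be Silver forcing. There is a $\mathbb{V}$-name $\dot{\mathcal{X}}$ for a sequence of reals $\langle \dot x_n : n\in\omega\rangle$ (each in ${}^\omega 2\subseteq{}^\omega\omega$) such that there is no condition $p\in\mathbb{V}$ and no $\mathcal{W}$ (in the ground model) with $p\Vdash \check{\mathcal{W}}$ is a shrink wrapper for $\dot{\mathcal{X}}$.
   Context: A tree $T\subseteq{}^{<\omega}2$ is a Silver tree if it is leafless and there is an infinite set $L\subseteq\omega$ such that for each $t\in T$: if $\mathrm{dom}(t)\in L$ then both $t^\frown0,t^\frown1\in T$; if $\mathrm{dom}(t)\notin L$ then exactly one of $t^\frown 0,t^\frown1$ is in $T$; and for any two branches $x_1,x_2\in[T]$ and $l\notin L$, $x_1(l)=x_2(l)$. Silver forcing $\mathbb{V}$ is the set of Silver trees ordered by inclusion. A function $f:\omega\to\omega\setminus\{0\}$ is given. A tree $T \subseteq {}^{<\omega}\omega$ obeys $f$ if for each $l\in\omega$ the set $\{n\in\omega : t^\frown n\in T \text{ for some } t \text{ on level } l \text{ of } T\}$ has size at most $f(l)$. Fixed throughout (in the ground model): a sequence $\langle f_i : i<\omega\rangle$ of functions $f_i:\omega\to\omega\setminus\{0\}$ such that $(i,l)\mapsto f_i(l)$ is computable and finite-to-one; a computable bijection $\eta:\omega\to[\omega]^2$; and a finite-to-one function $\Phi:{}^{<\omega}2\times\omega\to\omega$. A shrink wrapper for a sequence of reals $\mathcal{X}=\langle x_n : n\in\omega\rangle$ is a pair $\langle\mathcal{F},I\rangle$ where $I:\omega\to[{}^\omega\omega]^{<\omega}$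 and $\mathcal{F}$ is a family of functions $F_{\tilde n,n}$ for $\tilde n\in\omega$, $n\in\eta(\tilde n)$, such that: 1) $F_{\tilde n,n}:{}^{\tilde n}2\to\mathcal{P}({}^{<\omega}\omega)$ and for each $s\in{}^{\tilde n}2$, $F_{\tilde n,n}(s)$ is a leafless tree obeying $f_{\Phi(s,n)}$; 2) for each $\tilde n$ and $n\in\eta(\tilde n)$ there is $s\in{}^{\tilde n}2$ with $x_n\in[F_{\tilde n,n}(s)]$; 3) for $\{n_1,n_2\}=\eta(\tilde n)$ and all $s_1,s_2\in{}^{\tilde n}2$, letting $C_1=[F_{\tilde n,n_1}(s_1)]$ and $C_2=[F_{\tilde n,n_2}(s_2)]$, one of the following holds: (a) $C_1=C_2$, and if $x_{n_1}\in C_1$ or $x_{n_2}\in C_2$ then $x_{n_1}=x_{n_2}$; (b) there is $x\in I(n_1)\cap I(n_2)$ with $C_1=C_2=\{x\}$; (c) $C_1\cap C_2=\emptyset$. Here $[T]$ denotes the set of infinite branches of $T$. *)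

(* Defs.v *)
From HB Require Import structures.
From mathcomp Require Import all_boot finmap.
From mathcomp Require Import boolp classical_sets functions cardinality.

Set Implicit Arguments.
Unset Strict Implicit.
Unset Printing Implicit Defensive.

Local Open Scope classical_set_scope.
Local Open Scope card_scope.

(** * Trees *)

Section Trees.
Variable A : Type.
Implicit Types (T : set (seq A)) (x : nat -> A).

(* The empty set counts as a tree. *)
Definition is_tree T := forall t u : seq A, T (t ++ u) -> T t.

Definition leafless T := forall t, T t -> exists a, T (rcons t a).

Definition branches T : set (nat -> A) :=
  [set x | forall n, T (mkseq x n)].

End Trees.

Definition obeys (f : nat -> nat) (T : set (seq nat)) :=
  forall l, [set n | exists t, [/\ size t = l, T t & T (rcons t n)]]
            #<= `I_(f l).

(** * Silver forcing *)

(* Conditions are nonempty: the empty set satisfies all the other clauses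
   vacuously and would be a least condition. *)
Definition silver_tree (T : set (seq bool)) :=
  [/\ is_tree T, T [::], leafless T &
      exists L : set nat,
        [/\ infinite_set L,
            forall t, T t -> L (size t) ->
              T (rcons t false) /\ T (rcons t true),
            forall t, T t -> ~ L (size t) -> exists! b, T (rcons t b) &
            forall x1 x2, branches T x1 -> branches T x2 ->
              forall l, ~ L l -> x1 l = x2 l]].

Record silver := Silver {
  silver_set :> set (seq bool);
  silver_setP : silver_tree silver_set }.

Definition silver_le (q p : silver) : Prop := silver_set q `<=` silver_set p.

(** * Names and the forcing relation *)

(* The universe of types plays the role of the ground model.  A name for a
   subset of (the check name of) a ground model set [A] is a set of pairs
   (a, p), standing for the pairs of the check name of a and the condition p;
   every subset of [A] in the extension has such a name. *)
Definition name (A : Type) := set (A * silver).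

Definition check (A : Type) (B : set A) : name A := [set ap | B ap.1].

(* The forcing language.  [Ground P] is a statement about check names that is
   absolute between the ground model and the extension.  [Mem a s] says that
   the check name of [a] belongs to the set named by [s].  In [Forall phi] the
   domain [D] is either a ground model set (quantification over the elements
   of its check name) or a type [name A] (quantification over all the subsets
   of [A] in the extension). *)
Inductive formula : Type :=
| Ground of Prop
| Mem (A : Type) of A & name A
| And of formula & formula
| Not of formula
| Forall (D : Type) of (D -> formula).

Fixpoint forces (p : silver) (phi : formula) : Prop :=
  match phi with
  | Ground P => P
  | Mem A a s =>
      forall q, silver_le q p ->
        exists2 r, silver_le r q & exists2 c, s (a, c) & silver_le r c
  | And phi1 phi2 => forces p phi1 /\ forces p phi2
  | Not phi1 => forall q, silver_le q p -> ~ forces q phi1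
  | Forall D phi1 => forall d : D, forces p (phi1 d)
  end.

Definition Or phi psi := Not (And (Not phi) (Not psi)).
Definition Imp phi psi := Not (And phi (Not psi)).
Definition Iff phi psi := And (Imp phi psi) (Imp psi phi).
Definition Exists (D : Type) (phi : D -> formula) :=
  Not (Forall (fun d => Not (phi d))).

Definition Eq (A : Type) (s t : name A) :=
  Forall (fun a : A => Iff (Mem a s) (Mem a t)).

(** * Reals and sequences of reals in the extension *)

(* Functions are identified with their graphs. *)
Definition real_name := name (nat * nat).

Definition graph (x : nat -> nat) : set (nat * nat) :=
  [set kv | kv.2 = x kv.1].

Definition IsReal (y : real_name) :=
  Forall (fun k : nat =>
    And (Exists (fun v : nat => Mem (k, v) y))
        (Forall (fun v : nat => Forall (fun w : nat =>
           Imp (And (Mem (k, v) y) (Mem (k, w) y)) (Ground (v = w)))))).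

Definition IsBinaryReal (y : real_name) :=
  And (IsReal y)
      (Forall (fun k : nat => Forall (fun v : nat =>
         Imp (Mem (k, v) y) (Ground (v < 2))))).

(* [t] is an initial segment of the real [y]. *)
Definition Initial (t : seq nat) (y : real_name) :=
  Forall (fun i : 'I_(size t) => Mem (val i, nth 0 t i) y).

(* [y] is a branch, in the extension, of the ground model tree [T]. *)
Definition InBranches (y : real_name) (T : set (seq nat)) :=
  And (IsReal y) (Forall (fun t : seq nat => Imp (Initial t y) (Ground (T t)))).

(* Names for sequences of reals: the triple (n, (k, v)) says that the n-th
   real takes the value v at k. *)
Definition real_seq_name := name (nat * (nat * nat)).

Definition term (X : real_seq_name) (n : nat) : real_name :=
  [set kvp | X ((n, kvp.1), kvp.2)].

Definition IsBinaryRealSeq (X : real_seq_name) :=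
  Forall (fun n : nat => IsBinaryReal (term X n)).

(** * Computability *)

(* General recursive functions: the least class of total functions containing
   the zero, successor and projection functions and closed under composition,
   primitive recursion and minimization of regular functions. *)
Inductive computable : forall k, (k.-tuple nat -> nat) -> Prop :=
| computable_zero k : computable (fun _ : k.-tuple nat => 0)
| computable_succ : computable (fun v : 1.-tuple nat => (thead v).+1)
| computable_proj k (i : 'I_k) :
    computable (fun v : k.-tuple nat => tnth v i)
| computable_comp k m (g : m.-tuple nat -> nat)
    (h : 'I_m -> k.-tuple nat -> nat) :
    computable g -> (forall i, computable (h i)) ->
    computable (fun v => g [tuple h i v | i < m])
| computable_rec k (g : k.-tuple nat -> nat) (h : k.+2.-tuple nat -> nat) :
    computable g -> computable h ->
    computable (fun v : k.+1.-tuple nat =>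
      nat_rect (fun _ => nat) (g [tuple of behead v])
        (fun j z => h [tuple of j :: z :: behead v]) (thead v))
| computable_mu k (g : k.+1.-tuple nat -> nat)
    (reg : forall v : k.-tuple nat, exists y, g [tuple of y :: v] == 0) :
    computable g -> computable (fun v => ex_minn (reg v))
| computable_ext k (g h : k.-tuple nat -> nat) :
    g =1 h -> computable g -> computable h.

Definition computable1 (g : nat -> nat) :=
  computable (fun v : 1.-tuple nat => g (thead v)).

Definition computable2 (g : nat -> nat -> nat) :=
  computable (fun v : 2.-tuple nat => g (tnth v ord0) (tnth v ord_max)).

Definition finite_to_one (A : Type) (g : A -> nat) :=
  forall m, finite_set [set a | g a = m].

Definition pairs := {A : {fset nat} | (#|` A|)%fset == 2}.

Definition computable_pairs (eta : nat -> pairs) :=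
  exists a b : nat -> nat,
    [/\ computable1 a, computable1 b &
        forall k, val (eta k) = [fset a k; b k]%fset].

(** * Shrink wrappers *)

(* [wfam m n s] is F_(m,n)(s); only the values at n in eta(m) are relevant. *)
Record wrapper := Wrapper {
  wfam : forall m : nat, nat -> m.-tuple bool -> set (seq nat);
  wfin : nat -> set (nat -> nat) }.

Section ShrinkWrapper.
Variables (f : nat -> nat -> nat) (eta : nat -> pairs).
Variables (Phi : seq bool * nat -> nat) (W : wrapper) (X : real_seq_name).

Let F := wfam W.
Let I := wfin W.

Definition WrapTrees :=
  Forall (fun m : nat => Forall (fun n : nat => Imp (Ground (n \in val (eta m)))
    (Forall (fun s : m.-tuple bool =>
       Ground [/\ is_tree (F n s), leafless (F n s) &
                  obeys (f (Phi (tval s, n))) (F n s)])))).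

Definition WrapCovers :=
  Forall (fun m : nat => Forall (fun n : nat => Imp (Ground (n \in val (eta m)))
    (Exists (fun s : m.-tuple bool => InBranches (term X n) (F n s))))).

Definition SameBranches (T1 T2 : set (seq nat)) :=
  Forall (fun y : real_name => Iff (InBranches y T1) (InBranches y T2)).

Definition DisjointBranches (T1 T2 : set (seq nat)) :=
  Forall (fun y : real_name => Not (And (InBranches y T1) (InBranches y T2))).

(* The only branch of [T] in the extension is the ground model real [x]. *)
Definition SingleBranch (T : set (seq nat)) (x : nat -> nat) :=
  Forall (fun y : real_name =>
    Iff (InBranches y T) (And (IsReal y) (Eq y (check (graph x))))).

Definition WrapSeparates :=
  Forall (fun m : nat => Forall (fun n1 : nat => Forall (fun n2 : nat =>
    Imp (Ground (val (eta m) = [fset n1; n2]%fset))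
    (Forall (fun s1 : m.-tuple bool => Forall (fun s2 : m.-tuple bool =>
      let T1 := F n1 s1 in
      let T2 := F n2 s2 in
      let x1 := term X n1 in
      let x2 := term X n2 in
      Or (And (SameBranches T1 T2)
              (Imp (Or (InBranches x1 T1) (InBranches x2 T2)) (Eq x1 x2)))
     (Or (Exists (fun x : nat -> nat =>
            And (Ground (I n1 x /\ I n2 x))
                (And (SingleBranch T1 x) (SingleBranch T2 x))))
         (DisjointBranches T1 T2)))))))).

Definition IsShrinkWrapper :=
  And (Ground (forall n, finite_set (I n)))
      (And WrapTrees (And WrapCovers WrapSeparates)).

End ShrinkWrapper.

(* Main.v *)
Require Import Defs.
From HB Require Import structures.
From mathcomp Require Import all_boot finmap.
From mathcomp Require Import boolp classical_sets functions cardinality.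

(** Let c be the Silver real and let x_n be c with its n-th bit flipped.  Suppose
    p forces W to be a shrink wrapper, and pick distinct splitting levels n1, n2
    of p and m with eta(m) = {n1, n2}.  Some q below p forces x_n1 into the tree
    F_(m,n1)(s1).  Flipping the bits n1 and n2 preserves p and exchanges x_n1 and
    x_n2, so the image of q is below p and forces x_n2 into F_(m,n1)(s1); below it
    some r also forces x_n2 into F_(m,n2)(s2).  Thus the two trees share the branch
    x_n2, which is neither equal to x_n1 nor in the ground model. *)

Set Implicit Arguments.
Unset Strict Implicit.
Unset Printing Implicit Defensive.

Local Open Scope classical_set_scope.

(** * Silver trees as partial functions *)

(** Dependent choice: a chosen one-step extension is iterated from [t], and the branch is the union
    of the resulting chain. *)
Lemma leafless_branch (A : Type) (T : set (seq A)) (t : seq A) :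
  is_tree T -> leafless T -> T t ->
  exists2 x, branches T x & mkseq x (size t) = t.
Proof.
move=> treeT llT Tt; have [a0 _] := llT _ Tt.
have /choice[next nextP] : forall u, exists a, T u -> T (rcons u a).
  by move=> u; case: (pselect (T u)) => [/llT[a Ta]|nTu]; [exists a|exists a0].
pose ext i := iter i (fun u => rcons u (next u)) t.
have Text i : T (ext i) by elim: i => //= i; exact: nextP.
have size_ext i : size (ext i) = size t + i.
  by elim: i => [|i IH]; rewrite ?addn0 //= size_rcons IH addnS.
have nth_ext i j k : k < size (ext i) -> nth a0 (ext (i + j)) k = nth a0 (ext i) k.
  move=> lt_k; elim: j => [|j IH]; rewrite ?addn0 // addnS /= nth_rcons size_ext.
  by rewrite size_ext in lt_k; rewrite addnA (ltn_addr _ lt_k).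
(* Stage [k.+1] has length at least [k.+1], so the default [a0] is never read. *)
pose x k := nth a0 (ext k.+1) k.
have xE i k : k < size (ext i) -> nth a0 (ext i) k = x k.
  move=> lt_k; rewrite /x; case: (leqP i k.+1) => [le_ik|/ltnW le_ki].
    by rewrite -(subnKC le_ik) nth_ext.
  by rewrite -(subnKC le_ki) nth_ext // size_ext addnS ltnS leq_addl.
have take_ext i n : n <= size (ext i) -> mkseq x n = take n (ext i).
  move=> le_n; apply: (@eq_from_nth _ a0) => [|k]; rewrite size_mkseq.
    by rewrite size_takel.
  by move=> lt_k; rewrite nth_mkseq // nth_take // xE // (leq_trans lt_k).
exists x => [n|]; last by rewrite (take_ext 0) ?take_size.
rewrite (take_ext n) ?size_ext ?leq_addl //.
by apply: (treeT _ (drop n (ext n))); rewrite cat_take_drop.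
Qed.

(** The nodes compatible with the partial function [g] restricted to the complement of [L]; the
    values of the total function [g] on [L] have no effect. *)
Definition cylinder (L : set nat) (g : nat -> bool) : set (seq bool) :=
  [set t | forall k, k < size t -> ~ L k -> nth false t k = g k].

Lemma cylinder_rcons (L : set nat) (g : nat -> bool) t b :
  cylinder L g (rcons t b) <->
  cylinder L g t /\ (~ L (size t) -> b = g (size t)).
Proof.
split=> [cyl|[cyl tb] k].
  split=> [k lt_k nLk|nL].
    by have := cyl k; rewrite size_rcons nth_rcons lt_k; apply=> //; exact: ltnW.
  by have := cyl (size t); rewrite size_rcons nth_rcons ltnn eqxx; exact.
rewrite size_rcons ltnS nth_rcons leq_eqVlt; case: ltngtP => //= [lt_k _|-> _].
  exact: cyl.
exact: tb.
Qed.

Lemma cylinder_silver (L : set nat) (g : nat -> bool) :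
  infinite_set L -> silver_tree (cylinder L g).
Proof.
move=> infL; split=> [t u cyl k lt_k nLk| |t cyl|]; first 2 last.
- by exists (g (size t)); apply/cylinder_rcons.
- exists L; split=> // [t cyl Lt|t cyl nLt|x1 x2 br1 br2 l nLl].
  + by split; apply/cylinder_rcons; split.
  + exists (g (size t)); split; first exact/cylinder_rcons.
    by move=> b /cylinder_rcons[_ ->].
  + have := br1 l.+1 l; have := br2 l.+1 l.
    by rewrite !size_mkseq !nth_mkseq // => -> // ->.
- by have := cyl k; rewrite nth_cat lt_k size_cat ltn_addr //; exact.
- by [].
Qed.

(** Any branch [z] can serve as [g]: all branches agree off [L], so at a level outside [L] the
    unique successor must follow [z]. *)
Lemma silver_cylinder (p : silver) :
  exists L g, infinite_set L /\ silver_set p = cylinder L g.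
Proof.
have [treep p0 llp [L [infL split_p nsplit_p fix_p]]] := silver_setP p.
have [z br_z _] := leafless_branch treep llp p0.
have sub t : silver_set p t -> cylinder L z t.
  move=> pt k lt_k nLk; have [x br_x <-] := leafless_branch treep llp pt.
  by rewrite nth_mkseq //; exact: fix_p nLk.
exists L, z; split=> //; apply/seteqP; split=> // t.
elim/last_ind: t => // t b IH /cylinder_rcons[/IH pt tb].
case: (pselect (L (size t))) => [Lt|nLt].
  by have [] := split_p _ pt Lt; case: b {tb}.
have [b' [ptb' _]] := nsplit_p _ pt nLt.
have /cylinder_rcons[_ /(_ nLt) b'E] := sub _ ptb'.
by rewrite (tb nLt) -b'E.
Qed.

Lemma silver_le_trans (r q p : silver) :
  silver_le r q -> silver_le q p -> silver_le r p.
Proof. by move=> le_rq le_qp t /le_rq /le_qp. Qed.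

(** Deleting the finitely many levels below [size t] leaves the splitting set infinite, and the
    values of [t] are prescribed there. *)
Lemma silver_restrict (p : silver) (t : seq bool) : silver_set p t ->
  exists2 q : silver, silver_le q p &
    forall u, silver_set q u -> forall k, k < size t -> k < size u ->
      nth false u k = nth false t k.
Proof.
have [L [g [infL pE]]] := silver_cylinder p; rewrite pE => pt.
pose L' := L `\` `I_(size t).
pose g' k := if k < size t then nth false t k else g k.
have infL' : infinite_set L' by apply: infinite_setD => //; exact: finite_II.
exists (Silver (cylinder_silver g' infL')) => u /=.
  rewrite pE => cyl k lt_u nLk.
  have /(cyl _ lt_u) -> : ~ L' k by case.
  by rewrite /g'; case: ifP => // /pt ->.
move=> cyl k lt_t lt_u.
by rewrite cyl // /g' ?lt_t // => -[_]; exact.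
Qed.

Lemma silver_extend (p : silver) n : exists2 t, silver_set p t & size t = n.
Proof.
have [_ p0 llp _] := silver_setP p.
elim: n => [|n [t /llp[b ptb] <-]]; first by exists [::].
by exists (rcons t b); rewrite ?size_rcons.
Qed.

Lemma silver_splits (p : silver) :
  exists2 L : set nat, infinite_set L &
    forall l b, L l ->
      exists2 t, silver_set p t & size t = l.+1 /\ nth false t l = b.
Proof.
have [_ _ _ [L [infL split_p _ _]]] := silver_setP p.
exists L => // l b Ll; have [t pt sz_t] := silver_extend p l.
have [pt0 pt1] : silver_set p (rcons t false) /\ silver_set p (rcons t true).
  by apply: split_p; rewrite ?sz_t.
exists (rcons t b); first by case: b.
by rewrite size_rcons nth_rcons sz_t ltnn eqxx.
Qed.

(** * The forcing relation *)

Lemma forces_mono phi (q p : silver) :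
  silver_le q p -> forces p phi -> forces q phi.
Proof.
elim: phi => [P|A a s|phi1 IH1 phi2 IH2|phi IH|D phi IH] //= le_qp.
- by move=> Hp r le_rq; apply: Hp; exact: silver_le_trans le_qp.
- by case=> H1 H2; split; [exact: IH1|exact: IH2].
- by move=> Hp r le_rq; apply: Hp; exact: silver_le_trans le_qp.
- by move=> Hp d; apply: IH.
Qed.

Lemma forces_And p phi psi :
  forces p (And phi psi) <-> forces p phi /\ forces p psi.
Proof. by []. Qed.

Lemma forces_Forall p (D : Type) (phi : D -> formula) :
  forces p (Forall phi) <-> forall d, forces p (phi d).
Proof. by []. Qed.

(** A double negation is removed by passing to a stronger condition. Implication and existence are
    encoded by negations, so their eliminations below pay the same price. *)
Lemma forces_NN p phi :
  forces p (Not (Not phi)) -> exists2 q, silver_le q p & forces q phi.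
Proof.
move=> /(_ p (fun _ H => H)) /existsNP[q] /not_implyP[le_qp] /contrapT Hq.
by exists q.
Qed.

Lemma forces_Imp_elim p phi psi :
  forces p (Imp phi psi) -> forces p phi ->
  exists2 q, silver_le q p & forces q psi.
Proof.
move=> imp Hphi; apply: forces_NN => q le_qp nHpsi.
by apply: (imp q le_qp); split=> //; exact: forces_mono le_qp _.
Qed.

Lemma forces_Imp_intro p phi psi :
  (forall q, silver_le q p -> forces q phi -> forces q psi) ->
  forces p (Imp phi psi).
Proof. by move=> H q le_qp [/(H q le_qp) Hpsi /(_ q (fun _ H => H))]. Qed.

Lemma forces_Exists_elim p (D : Type) (phi : D -> formula) :
  forces p (Exists phi) -> exists2 q, silver_le q p & exists d, forces q (phi d).
Proof.
move=> /(_ p (fun _ H => H)) /existsNP[d] /existsNP[q] /not_implyP[le_qp] /contrapT Hq.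
by exists q => //; exists d.
Qed.

Lemma forces_Or_intror p phi psi : forces p psi -> forces p (Or phi psi).
Proof.
move=> Hpsi q le_qp [_ /(_ q (fun _ H => H))].
by apply; exact: forces_mono le_qp _.
Qed.

(** Hypotheses and conclusion quantify alike over conditions below [p], so nested disjunctions are
    refuted by iteration. *)
Lemma not_forces_Or p phi psi :
  (forall q, silver_le q p -> ~ forces q phi) ->
  (forall q, silver_le q p -> ~ forces q psi) ->
  forall q, silver_le q p -> ~ forces q (Or phi psi).
Proof.
move=> nphi npsi q le_qp /(_ q (fun _ H => H)); apply.
by split=> r le_rq; [apply: nphi|apply: npsi]; exact: silver_le_trans le_qp.
Qed.

(** * The reals obtained by flipping one bit of the Silver real *)

Definition flip_bit (n : nat) (t : seq bool) (k : nat) : nat :=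
  nth false t k (+) (k == n).

Definition flip_seq (n : nat) (t : seq bool) : seq nat :=
  mkseq (flip_bit n t) (size t).

Definition decides (n k v : nat) (p : silver) :=
  forall t, silver_set p t -> k < size t -> v = flip_bit n t k.

(** The name contains every condition that decides a value, so that forcing membership coincides
    with [decides]. *)
Definition flip_reals : real_seq_name :=
  [set z | decides z.1.1 z.1.2.1 z.1.2.2 z.2].

Lemma forces_Mem_flip p n k v :
  forces p (Defs.Mem (k, v) (term flip_reals n)) <-> decides n k v p.
Proof.
split=> [Hp t pt lt_k|dec q le_qp].
  have [q le_qp qt] := silver_restrict pt.
  have [r le_rq [c dec le_rc]] := Hp q le_qp.
  (* A node of [r] of length [size t] agrees with [t] and is also a node of the deciding condition
     [c], so the decided value is read off from [t]. *)
  have [u ru sz_u] := silver_extend r (size t).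
  have lt_ku : k < size u by rewrite sz_u.
  have /= -> := dec u (le_rc _ ru) lt_ku.
  by rewrite /flip_bit (qt u) //; exact: le_rq.
by exists q => //; exists q => // t /le_qp pt; exact: dec.
Qed.

Lemma decides_restrict (p : silver) t : silver_set p t ->
  exists2 q : silver, silver_le q p &
    forall n k, k < size t -> decides n k (flip_bit n t k) q.
Proof.
move=> pt; have [q le_qp qt] := silver_restrict pt.
by exists q => // n k lt_k u qu lt_ku; rewrite /flip_bit (qt u).
Qed.

Lemma decides_inj p n k v w : decides n k v p -> decides n k w p -> v = w.
Proof.
have [t pt sz_t] := silver_extend p k.+1.
by move=> dv dw; rewrite (dv t) ?sz_t // (dw t) ?sz_t.
Qed.

Lemma forces_IsReal_flip p n : forces p (IsReal (term flip_reals n)).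
Proof.
apply/forces_Forall => k; apply/forces_And; split=> [q le_qp|].
  have [t qt sz_t] := silver_extend q k.+1.
  have [r le_rq dec] := decides_restrict qt.
  move=> /(_ (flip_bit n t k) r le_rq); apply; apply/forces_Mem_flip/dec.
  by rewrite sz_t.
apply/forces_Forall => v; apply/forces_Forall => w.
apply: forces_Imp_intro => q _ /forces_And[/forces_Mem_flip dv /forces_Mem_flip dw] /=.
exact: decides_inj dv dw.
Qed.

Lemma forces_IsBinaryRealSeq_flip p : forces p (IsBinaryRealSeq flip_reals).
Proof.
apply/forces_Forall => n; apply/forces_And.
split; first exact: forces_IsReal_flip.
apply/forces_Forall => k; apply/forces_Forall => v.
apply: forces_Imp_intro => q _ /forces_Mem_flip dec /=.
have [t qt sz_t] := silver_extend q k.+1.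
by rewrite (dec t qt) ?sz_t // /flip_bit; case: (_ (+) _).
Qed.

(** Each node of [p] can be made an initial segment of the Silver real by restriction, so every
    finite flipped node must already lie in [T]. *)
Lemma forces_InBranches_flip p n (T : set (seq nat)) :
  forces p (InBranches (term flip_reals n) T) <->
  forall t, silver_set p t -> T (flip_seq n t).
Proof.
split=> [/forces_And[_ /forces_Forall Hp] t pt|HT].
  have [q le_qp dec] := decides_restrict pt.
  have Hini : forces q (Initial (flip_seq n t) (term flip_reals n)).
    apply/forces_Forall => -[i lt_i]; apply/forces_Mem_flip => /=.
    by rewrite size_mkseq in lt_i; rewrite nth_mkseq //; exact: dec.
  (* [T] is a ground model tree, so membership forced by some stronger condition is simply true. *)
  by have [r] := forces_Imp_elim (forces_mono le_qp (Hp (flip_seq n t))) Hini.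
apply/forces_And; split; first exact: forces_IsReal_flip.
apply/forces_Forall => t.
apply: forces_Imp_intro => q le_qp /forces_Forall Hini /=.
have [u qu sz_u] := silver_extend q (size t).
suff -> : t = flip_seq n u by apply/HT/le_qp.
apply: (@eq_from_nth _ 0) => [|i lt_i]; first by rewrite size_mkseq.
have /forces_Mem_flip /(_ u qu) := Hini (Ordinal lt_i).
by rewrite /= sz_u => -> //; rewrite nth_mkseq // sz_u.
Qed.

(** The two reals differ at position [n1], where only the first has its bit flipped. *)
Lemma not_forces_Eq_flip p n1 n2 : n1 != n2 ->
  ~ forces p (Eq (term flip_reals n1) (term flip_reals n2)).
Proof.
move=> ne_n /forces_Forall eqp.
have [t pt sz_t] := silver_extend p n1.+1.
have [q le_qp dec] := decides_restrict pt.
have lt_n : n1 < size t by rewrite sz_t.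
have /forces_Mem_flip Hm := dec n1 _ lt_n.
have /forces_And[imp _] := eqp (n1, flip_bit n1 t n1).
have [r le_rq /forces_Mem_flip dec2] :=
  forces_Imp_elim (forces_mono le_qp imp) Hm.
have decr : decides n2 n1 (flip_bit n2 t n1) r.
  by move=> u /le_rq; exact: dec.
have := decides_inj dec2 decr.
by rewrite /flip_bit eqxx (negPf ne_n); case: nth.
Qed.

Lemma not_forces_Eq_check_flip p n (x : nat -> nat) :
  ~ forces p (Eq (term flip_reals n) (Defs.check (graph x))).
Proof.
move=> /forces_Forall eqp; have [L infL splitL] := silver_splits p.
have [l Ll] := infinite_setN0 infL.
(* After the flip at [n], the real takes at [l] the value 1 if [x l] is 0 and the value 0 otherwise,
   hence never [x l]. *)
have [t pt [sz_t nth_t]] := splitL l ((x l == 0) (+) (l == n)) Ll.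
have [q le_qp dec] := decides_restrict pt.
have /forces_And[_ imp] := eqp (l, x l).
have Hm : forces q (Defs.Mem (l, x l) (Defs.check (graph x))).
  by move=> r _; exists r => //; exists r.
have [r le_rq /forces_Mem_flip dec'] :=
  forces_Imp_elim (forces_mono le_qp imp) Hm.
have decr : decides n l (flip_bit n t l) r.
  by move=> u /le_rq; apply: dec; rewrite sz_t.
have := decides_inj dec' decr.
by rewrite /flip_bit nth_t addbK; case: (x l) => [|[]].
Qed.

(** Flipping bits [n1] and [n2] carries [q] to [r]. It preserves [p] since both levels split there,
    and flipping bit [n2] of a node amounts to flipping bit [n1] of its image. *)
Lemma silver_swap (p q : silver) (L : set nat) g n1 n2 :
  silver_set p = cylinder L g -> L n1 -> L n2 -> silver_le q p ->
  exists2 r : silver, silver_le r p &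
    forall t, silver_set r t ->
      exists2 u, silver_set q u & flip_seq n2 t = flip_seq n1 u.
Proof.
move=> pE Ln1 Ln2 le_qp.
have [L' [g' [infL' qE]]] := silver_cylinder q.
pose swap k := (k == n1) (+) (k == n2).
(* The change of [g'] matters only off [L']; at levels in [L'] both values are allowed before and
   after the swap. *)
pose r := Silver (cylinder_silver (fun k => g' k (+) swap k) infL').
pose sw t := mkseq (fun k => nth false t k (+) swap k) (size t).
have q_sw t : silver_set r t -> silver_set q (sw t).
  rewrite qE => rt k; rewrite size_mkseq => lt_k nL'k.
  by rewrite nth_mkseq // (rt k) // addbK.
exists r => [t rt|t rt].
  rewrite pE => k lt_k nLk; have := le_qp _ (q_sw _ rt).
  rewrite pE => /(_ k); rewrite size_mkseq nth_mkseq // => <- //.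
  have /negPf k_n1 : k != n1 by apply: contra_notN nLk => /eqP ->.
  have /negPf k_n2 : k != n2 by apply: contra_notN nLk => /eqP ->.
  by rewrite /swap k_n1 k_n2 !addbF.
exists (sw t); first exact: q_sw.
apply: (@eq_from_nth _ 0); rewrite /flip_seq !size_mkseq // => i lt_i.
rewrite !nth_mkseq ?size_mkseq // /flip_bit nth_mkseq // /swap.
by case: nth; case: (i == n1); case: (i == n2).
Qed.

Theorem theorem4p5
  (f : nat -> nat -> nat)
  (f_gt0 : forall i l : nat, 0 < f i l)
  (f_computable : computable2 f)
  (f_finite_to_one : finite_to_one (fun il : nat * nat => f il.1 il.2))
  (eta : nat -> pairs)
  (eta_bijective : bijective eta)
  (eta_computable : computable_pairs eta)
  (Phi : seq bool * nat -> nat)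
  (Phi_finite_to_one : finite_to_one Phi) :
  exists X : real_seq_name,
    (forall p : silver, forces p (IsBinaryRealSeq X)) /\
    ~ (exists (p : silver) (W : wrapper),
         forces p (IsShrinkWrapper f eta Phi W X)).
Proof.
exists flip_reals; split; first exact: forces_IsBinaryRealSeq_flip.
case=> p [W] /forces_And[_] /forces_And[_] /forces_And[covers separates].
have {}covers m n : forces p (Imp (Ground (n \in val (eta m)))
    (Exists (fun s => InBranches (term flip_reals n) (@wfam W m n s)))).
  by move/forces_Forall: covers => /(_ m) /forces_Forall.
have {}separates m n1 n2 := iffLR (forces_Forall _ _)
  (iffLR (forces_Forall _ _) (iffLR (forces_Forall _ _) separates m) n1) n2.
have [L [g [infL pE]]] := silver_cylinder p.
have [n1 Ln1] := infinite_setN0 infL.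
have [n2 [Ln2 /eqP ne_n]] : exists n, L n /\ n <> n1.
  have /infinite_setN0[n [Ln nn1]] : infinite_set (L `\ n1).
    by apply: infinite_setD => //; exact: finite_set1.
  by exists n.
have card_n : (#|` [fset n1; n2]%fset|)%fset == 2.
  by rewrite cardfs2 [n1 == n2]eq_sym ne_n.
have [m eta_m] : exists m, val (eta m) = [fset n1; n2]%fset.
  have [theta _ etaK] := eta_bijective.
  pose e : pairs := exist _ [fset n1; n2]%fset card_n.
  by exists (theta e); rewrite etaK.
have cover n q : n \in val (eta m) -> silver_le q p ->
    exists2 r, silver_le r q & exists s : m.-tuple bool,
      forces r (InBranches (term flip_reals n) (wfam W n s)).
  move=> n_m le_qp.
  have [r le_rq Hr] :=
    forces_Imp_elim (forces_mono le_qp (covers m n)) n_m.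
  have [r' le_r'r Hr'] := forces_Exists_elim Hr.
  by exists r' => //; exact: silver_le_trans le_rq.
have [q le_qp [s1 /forces_InBranches_flip q_s1]] :
    exists2 q, silver_le q p & exists s : m.-tuple bool,
      forces q (InBranches (term flip_reals n1) (wfam W n1 s)).
  by apply: cover => //; rewrite eta_m !inE eqxx.
have [q' le_q'p swap_q'] := silver_swap pE Ln1 Ln2 le_qp.
have [r le_rq' [s2 r_s2]] :
    exists2 r, silver_le r q' & exists s : m.-tuple bool,
      forces r (InBranches (term flip_reals n2) (wfam W n2 s)).
  by apply: cover => //; rewrite eta_m !inE eqxx orbT.
(* Along nodes of [r], the real with index [n2] runs through values that the real with index [n1]
   takes along nodes of [q]. *)
have r_s1 : forces r (InBranches (term flip_reals n2) (wfam W n1 s1)).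
  by apply/forces_InBranches_flip => t /le_rq' /swap_q'[u qu ->]; exact: q_s1.
have le_rp := silver_le_trans le_rq' le_q'p.
have [r0 le_r0r sep] :=
  forces_Imp_elim (forces_mono le_rp (separates m n1 n2)) eta_m.
move: (iffLR (forces_Forall _ _) (iffLR (forces_Forall _ _) sep s1) s2).
move: le_r0r; apply: not_forces_Or.
  (* Alternative (a): the second real lies in its own tree, which would make the two reals equal. *)
  move=> w le_wr /forces_And[_ imp].
  have Hor : forces w (Or (InBranches (term flip_reals n1) (wfam W n1 s1))
                         (InBranches (term flip_reals n2) (wfam W n2 s2))).
    by apply: forces_Or_intror; exact: forces_mono le_wr _.
  have [w' _] := forces_Imp_elim imp Hor.
  by apply: not_forces_Eq_flip; rewrite eq_sym.
apply: not_forces_Or => w le_wr.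
  (* Alternative (b): the second real would equal the ground model real [x]. *)
  move=> /forces_Exists_elim[w1 le_w1w [x]].
  move=> /forces_And[_ /forces_And[_ /forces_Forall single]].
  have /forces_And[imp _] := single (term flip_reals n2).
  have le_w1r := silver_le_trans le_w1w le_wr.
  have [w2 _ /forces_And[_]] := forces_Imp_elim imp (forces_mono le_w1r r_s2).
  exact: not_forces_Eq_check_flip.
(* Alternative (c): the second real is a common branch of both trees. *)
move=> /forces_Forall /(_ (term flip_reals n2)) /(_ w (fun _ H => H)); apply.
have w_s1 := forces_mono le_wr r_s1; have w_s2 := forces_mono le_wr r_s2.
by split.
Qed.
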